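(* Let $m\in\mathbb{N}\setminus\{0\}$. For every $n\in\{1,\ldots,m\}$ and $i\in\{1,\ldots,n\}$, let $$a_{i,n}=\frac12\sup_{p\in\mathbb{N}}\left(\beta_{i,n,p}^2+\widetilde\beta_{i,n,p}^2+\eta_{i,n}^2+\sqrt{(\beta_{i,n,p}^2+\widetilde\beta_{i,n,p}^2+\eta_{i,n}^2)^2-4\beta_{i,n,p}^2\eta_{i,n}^2}\right),$$ and let $\theta_0=1$, $\theta_n=\sum_{i=1}^n\theta_{i-1}\sqrt{a_{i,n}}$ for $n\in\{1,\ldots,m\}$. Let $\alpha\in[1/2,1]$, $\gamma_\alpha=2^m(1-\alpha)$, and $$b_\alpha=\frac12\sup_{p\in\mathbb{N}}\left(c_p+\sqrt{c_p^2-4(\beta_{1,m,p}-\gamma_\alpha)^2(\eta_{1,m}-\gamma_\alpha)^2}\right),$$ where $c_p=(\beta_{1,m,p}-\gamma_\alpha)^2+(\eta_{1,m}-\gamma_\alpha)^2+\widetilde\beta_{1,m,p}^2$. If $$\sqrt{b_\alpha}-\sqrt{a_{1,m}}\le 2^m\alpha-2\theta_m,$$ then the virtual network $S=Q_m\circ U_m\circ\cdots\circ Q_1\circ U_1:\mathcal{X}\times\mathcal{X}\to\mathcal{X}\times\mathcal{X}$ is $\alpha$-averaged.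
   Context: $\mathcal{X},\mathcal{Y}$ are real Hilbert spaces of functions on $]0,1[$ (typically $L^2(0,1)$); $T:\mathcal{X}\to\mathcal{Y}$ is a compact linear integral operator $(Tx)(t)=\int_0^1 k(t,s)x(s)\,ds$ with $k\in L^2([0,1]^2)$; $D$ is a bounded linear operator from $\mathcal{X}$ to a real Hilbert space. $T^*T$ and $D^*D$ commute and are diagonalized in a common orthonormal basis $(v_p)_{p\in\mathbb{N}}$ of $\mathcal{X}$, with eigenvalues $(\beta_{T,p})_p$ and $(\beta_{D,p})_p$ respectively. $g:\mathcal{X}\to\,]-\infty,+\infty]$ is proper, lower semicontinuous and convex. For $n\in\{1,\ldots,m\}$, $\lambda_n,\mu_n,\tau_n,\eta_n$ are positive reals. $\mathrm{Id}$ is the identity. The proximity operator is $\mathrm{prox}_{f}(x)=\operatorname{argmin}_{y}\,(f(y)+\frac12\|x-y\|^2)$. $R_n=\mathrm{prox}_{\lambda_n\mu_ng}$, $W_n=\mathrm{Id}-\lambda_nT^*T-\lambda_n\tau_nD^*D$ on $\mathcal{X}$. On $\mathcal{X}\times\mathcal{X}$, with norm $\|(x,b)\|=\sqrt{\|x\|^2+\|b\|^2}$: $U_n(x,b)=(W_nx+\lambda_nb,\ \eta_nb)$ and $Q_n(x,b)=(R_nx,\ b)$. For $1\le i\le n\le m$ and $p\in\mathbb{N}$: $\beta_p^{(n)}=1-\lambda_n(\beta_{T,p}+\tau_n\beta_{D,p})$; $\beta_{i,n,p}=\prod_{j=i}^n\beta_p^{(j)}$; $\eta_{i,j}=\eta_j\cdots\eta_i$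 if $j\ge i$ and $\eta_{i,j}=1$ otherwise; $\widetilde\beta_{i,n,p}=\sum_{j=i}^{n-1}\beta_p^{(n)}\cdots\beta_p^{(j+1)}\lambda_j\eta_{i,j-1}+\lambda_n\eta_{i,n-1}$ (an empty sum is $0$). An operator $S:\mathcal{H}\to\mathcal{H}$ on a Hilbert space is $\alpha$-averaged if $S=(1-\alpha)\mathrm{Id}+\alpha R$ for some nonexpansive (1-Lipschitz) $R:\mathcal{H}\to\mathcal{H}$ (for $\alpha=1$ this means $S$ is nonexpansive). *)

(* Defs.v *)
From HB Require Import structures.
From mathcomp Require Import all_boot all_order all_algebra.
From mathcomp Require Import all_classical all_reals all_analysis.

Set Implicit Arguments.
Unset Strict Implicit.
Unset Printing Implicit Defensive.

Import Order.TTheory GRing.Theory Num.Theory.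
Import numFieldNormedType.Exports.

Local Open Scope classical_set_scope.
Local Open Scope ring_scope.

HB.mixin Record CompleteNormedModule_isHilbert (R : realType) X
    of CompleteNormedModule R X := {
  inner : X -> X -> R ;
  innerC : forall x y : X, inner x y = inner y x ;
  innerDZl : forall (a : R) (x y z : X),
    inner (a *: x + y) z = a * inner x z + inner y z ;
  innerxx : forall x : X, inner x x = `|x| ^+ 2
}.

#[short(type="hilbertType")]
HB.structure Definition Hilbert (R : realType) :=
  { X of CompleteNormedModule R X & CompleteNormedModule_isHilbert R X }.

Definition orthonormal_basis {R : realType} {X : hilbertType R}
    (v : nat -> X) : Prop :=
  (forall p q, inner (v p) (v q) = (p == q)%:R) /\
  closure [set x | exists (n : nat) (c : nat -> R),
                     x = \sum_(p < n) c p *: v p] = setT.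

(* Total on arbitrary maps; for a bounded linear [A] the set is a singleton, by
   the Riesz representation theorem. *)
Definition adjoint {R : realType} {X Y : hilbertType R} (A : X -> Y) (y : Y) : X :=
  get [set z | forall x, inner (A x) y = inner x z].

Definition bounded_operator {R : realType} {X Y : normedModType R}
    (A : X -> Y) : Prop :=
  exists M : R, forall x, `|A x| <= M * `|x|.

Definition compact_operator {R : realType} {X Y : normedModType R}
    (A : X -> Y) : Prop :=
  precompact (A @` [set x | `|x| <= 1]).

(* The elements of [X] are (classes modulo null sets of) measurable functions
   on ]0,1[: [ev x] is a representative of [x], so that [ev] is linear and
   injective up to almost everywhere equality. *)
Definition function_space {R : realType} (X : lmodType R)
    (ev : X -> R -> R) : Prop :=
  [/\ forall x, measurable_fun (`]0, 1[%classic : set R) (ev x : R -> R),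
      forall (a : R) (x y : X), {ae lebesgue_measure, forall t : R,
        t \in `]0, 1[ -> ev (a *: x + y) t = a * ev x t + ev y t}
    & forall x, {ae lebesgue_measure, forall t : R, t \in `]0, 1[ -> ev x t = 0} ->
        x = 0].

Definition L2_kernel {R : realType} (k : R * R -> R) : Prop :=
  measurable_fun (`[0, 1]%classic `*` `[0, 1]%classic : set (R * R)) k /\
  (lebesgue_measure \x lebesgue_measure)%E.-integrable
    (`[0, 1]%classic `*` `[0, 1]%classic : set (R * R))
    (fun z : R * R => (k z ^+ 2)%:E).

(* The integrability clause says that the integral makes sense; it is automatic
   when [X] is L^2(0,1). *)
Definition integral_operator {R : realType} {X Y : lmodType R}
    (evX : X -> R -> R) (evY : Y -> R -> R) (k : R * R -> R)
    (A : X -> Y) : Prop :=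
  forall x, {ae lebesgue_measure, forall t : R, t \in `]0, 1[ ->
    lebesgue_measure.-integrable `]0, 1[ (fun s : R => (k (t, s) * evX x s)%:E) /\
    evY (A x) t = \int[lebesgue_measure]_(s in `]0, 1[) (k (t, s) * evX x s)}.

Definition proper_function {R : realType} {X : Type} (g : X -> \bar R) : Prop :=
  (forall x, g x != -oo%E) /\ (exists x, g x != +oo%E).

Definition convex_ereal {R : realType} {X : lmodType R} (g : X -> \bar R) : Prop :=
  forall (t : R) (x y : X), 0 < t < 1 ->
    (g (t *: x + (1 - t) *: y)%R <= t%:E * g x + (1 - t)%:E * g y)%E.

Definition prox {R : realType} {X : normedModType R} (f : X -> \bar R) (x : X) : X :=
  get [set y | forall z, (f y + (2^-1 * `|x - y| ^+ 2)%:E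
                          <= f z + (2^-1 * `|x - z| ^+ 2)%:E)%E].

(* The norm is a parameter because the library norm of [X * X] is the maximum
   norm, whereas the network acts on the Hilbert product. *)
Definition nonexpansive {R : realType} {V : lmodType R} (N : V -> R)
    (A : V -> V) : Prop :=
  forall x y, N (A x - A y) <= N (x - y).

Definition averaged {R : realType} {V : lmodType R} (N : V -> R) (alpha : R)
    (S : V -> V) : Prop :=
  exists A : V -> V, nonexpansive N A /\
    forall x, S x = (1 - alpha) *: x + alpha *: A x.

Definition prod_norm {R : realType} {X : normedModType R} (z : X * X) : R :=
  Num.sqrt (`|z.1| ^+ 2 + `|z.2| ^+ 2).

Definition linear_layer {R : realType} {X Y Z : hilbertType R}
    (T : X -> Y) (D : X -> Z) (lam tau eta : nat -> R) (n : nat)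
    (z : X * X) : X * X :=
  (z.1 - lam n *: adjoint T (T z.1) - (lam n * tau n) *: adjoint D (D z.1)
     + lam n *: z.2,
   eta n *: z.2).

Definition prox_layer {R : realType} {X : hilbertType R} (g : X -> \bar R)
    (lam mu : nat -> R) (n : nat) (z : X * X) : X * X :=
  (prox (fun y => (lam n * mu n)%:E * g y)%E z.1, z.2).

Fixpoint virtual_network {R : realType} {X Y Z : hilbertType R}
    (T : X -> Y) (D : X -> Z) (g : X -> \bar R) (lam mu tau eta : nat -> R)
    (m : nat) : X * X -> X * X :=
  if m is n.+1 then
    prox_layer g lam mu n.+1 \o linear_layer T D lam tau eta n.+1
      \o virtual_network T D g lam mu tau eta n
  else id.

Definition beta_layer {R : realType} (lam tau bT bD : nat -> R) (n p : nat) : R :=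
  1 - lam n * (bT p + tau n * bD p).

Definition beta_prod {R : realType} (lam tau bT bD : nat -> R) (i n p : nat) : R :=
  \prod_(i <= j < n.+1) beta_layer lam tau bT bD j p.

Definition eta_prod {R : realType} (eta : nat -> R) (i j : nat) : R :=
  \prod_(i <= l < j.+1) eta l.

Definition beta_tilde {R : realType} (lam tau eta bT bD : nat -> R)
    (i n p : nat) : R :=
  \sum_(i <= j < n)
     beta_prod lam tau bT bD j.+1 n p * lam j * eta_prod eta i j.-1
  + lam n * eta_prod eta i n.-1.

Definition a_const {R : realType} (lam tau eta bT bD : nat -> R) (i n : nat) : R :=
  2^-1 * sup (range (fun p : nat =>
    let B := beta_prod lam tau bT bD i n p in
    let Bt := beta_tilde lam tau eta bT bD i n p in
    let E := eta_prod eta i n in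
    let c := B ^+ 2 + Bt ^+ 2 + E ^+ 2 in
    c + Num.sqrt (c ^+ 2 - 4 * B ^+ 2 * E ^+ 2))).

Definition b_const {R : realType} (lam tau eta bT bD : nat -> R) (m : nat)
    (alpha : R) : R :=
  let gam := 2 ^+ m * (1 - alpha) in
  2^-1 * sup (range (fun p : nat =>
    let B := beta_prod lam tau bT bD 1 m p in
    let Bt := beta_tilde lam tau eta bT bD 1 m p in
    let E := eta_prod eta 1 m in
    let c := (B - gam) ^+ 2 + (E - gam) ^+ 2 + Bt ^+ 2 in
    c + Num.sqrt (c ^+ 2 - 4 * (B - gam) ^+ 2 * (E - gam) ^+ 2))).

(* Main.v *)
(* Each resolvent is firmly nonexpansive: prox_(c g) = (Id + P) / 2 with P
   nonexpansive. Hence, for two inputs x and y, the differences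
   d_n = 2^n (S_n x - S_n y) of the partial networks satisfy
   d_(n+1) = U_(n+1) d_n + e_(n+1) with |e_(n+1)| <= |U_(n+1) d_n|. Unrolling,
   d_m = U_m...U_1 d_0 + sum_j U_m...U_(j+1) e_j, and theta is the recursion that
   bounds |e_n| <= theta_n |d_0|. Since S is alpha-averaged iff
   |d_m - 2^m (1 - alpha) d_0| <= 2^m alpha |d_0|, the triangle inequality leaves
   |U_m...U_1 - 2^m (1 - alpha)| - |U_m...U_1| + 2 theta_m <= 2^m alpha.
   On the invariant planes spanned by (v_p, 0) and (0, v_p) the compositions are
   triangular 2x2 matrices, whose spectral norms are the quantities in a_(i,n)
   and b_alpha. The adjoints and the proximity operators, defined by a choice of
   witness, exist because a strongly convex lower semicontinuous function on a
   Hilbert space has a minimizer. *)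

Require Import Defs.
From HB Require Import structures.
From mathcomp Require Import all_boot all_order all_algebra.
From mathcomp Require Import all_classical all_reals all_analysis.
From mathcomp Require Import zify ring lra.

Set Implicit Arguments.
Unset Strict Implicit.
Unset Printing Implicit Defensive.

Import Order.TTheory GRing.Theory Num.Theory.
Import numFieldNormedType.Exports.

Local Open Scope classical_set_scope.
Local Open Scope ring_scope.

(** * Inner products and strongly convex minimization *)

Lemma innerDl (R : realType) (X : hilbertType R) (x y z : X) :
  inner (x + y) z = inner x z + inner y z.
Proof. by rewrite -[x in x + y]scale1r innerDZl mul1r. Qed.

Lemma inner0l (R : realType) (X : hilbertType R) (z : X) : inner 0 z = 0.
Proof. by apply: (addrI (inner 0 z)); rewrite -innerDl !addr0. Qed.

Lemma innerZl (R : realType) (X : hilbertType R) (a : R) (x z : X) :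
  inner (a *: x) z = a * inner x z.
Proof. by rewrite -[a *: x]addr0 innerDZl inner0l addr0. Qed.

Lemma innerDr (R : realType) (X : hilbertType R) (x y z : X) :
  inner z (x + y) = inner z x + inner z y.
Proof. by rewrite innerC innerDl !(innerC _ z). Qed.

Lemma innerZr (R : realType) (X : hilbertType R) (a : R) (x z : X) :
  inner z (a *: x) = a * inner z x.
Proof. by rewrite innerC innerZl innerC. Qed.

Lemma innerNl (R : realType) (X : hilbertType R) (x z : X) :
  inner (- x) z = - inner x z.
Proof. by rewrite -scaleN1r innerZl mulN1r. Qed.

Lemma innerNr (R : realType) (X : hilbertType R) (x z : X) :
  inner z (- x) = - inner z x.
Proof. by rewrite -scaleN1r innerZr mulN1r. Qed.

Lemma sqr_normD (R : realType) (X : hilbertType R) (x y : X) :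
  `|x + y| ^+ 2 = `|x| ^+ 2 + 2 * inner x y + `|y| ^+ 2.
Proof. by rewrite -!innerxx innerDl !innerDr (innerC y x); ring. Qed.

Lemma sqr_normB (R : realType) (X : hilbertType R) (x y : X) :
  `|x - y| ^+ 2 = `|x| ^+ 2 - 2 * inner x y + `|y| ^+ 2.
Proof. by rewrite sqr_normD innerNr normrN; ring. Qed.

Lemma sqr_normZ (R : realType) (X : hilbertType R) (a : R) (x : X) :
  `|a *: x| ^+ 2 = a ^+ 2 * `|x| ^+ 2.
Proof. by rewrite -!innerxx innerZl innerZr; ring. Qed.

(** Cauchy-Schwarz comes for free from the triangle inequality, which the normed structure already
    provides: square it and cancel. *)
Lemma inner_le (R : realType) (X : hilbertType R) (x y : X) :
  inner x y <= `|x| * `|y|.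
Proof.
have h : `|x + y| ^+ 2 <= (`|x| + `|y|) ^+ 2.
  by rewrite lerXn2r ?nnegrE ?addr_ge0// ler_normD.
rewrite sqr_normD in h; nra.
Qed.

Lemma inner_ext (R : realType) (X : hilbertType R) (x y : X) :
  (forall z, inner z x = inner z y) -> x = y.
Proof.
move=> h; apply/eqP; rewrite -subr_eq0 -normr_eq0 -sqrf_eq0 -innerxx.
by rewrite innerDr innerNr h subrr.
Qed.

(** Testing a vector identity against an arbitrary vector turns it into a scalar identity that
    [field] decides. *)
Ltac vector_field :=
  apply: inner_ext => ?; rewrite !(innerDr, innerNr, innerZr); by field.

(** Stands in for letting t tend to 0; it extracts first-order optimality conditions from minimality
    along a segment. *)
Lemma le0_scale_limit (R : realType) (a b : R) :
  (forall t, 0 < t < 1 -> a <= t * b) -> a <= 0.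
Proof.
move=> h; rewrite leNgt; apply/negP => a0.
have b0 : 0 < b by have := h 2^-1 ltac:(lra); nra.
(* With this t, t * (a + b) = a / 2, hence t * b < a. *)
pose t := a / (2 * (a + b)).
have ab0 : 0 < 2 * (a + b) by lra.
have tE : t * (2 * (a + b)) = a by rewrite /t divfK// gt_eqF.
have t0 : 0 < t by rewrite divr_gt0.
have t1 : t < 1 by nra.
have := h t ltac:(by rewrite t0 t1).
nra.
Qed.

(** The midpoint inequality makes every minimizing sequence Cauchy. The last hypothesis is lower
    semicontinuity of F, extended by +oo outside [dom], in the form needed at the limit point. *)
Lemma strongly_convex_min (R : realType) (X : hilbertType R) (dom : set X)
    (F : X -> R) (c : R) :
  dom !=set0 -> (forall y, dom y -> c <= F y) ->
  (forall y z, dom y -> dom z -> exists2 w, dom w &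
     F w <= 2^-1 * F y + 2^-1 * F z - 8^-1 * `|y - z| ^+ 2) ->
  (forall x s, (forall e, 0 < e ->
       exists y, [/\ dom y, `|x - y| < e & F y < s + e]) ->
     dom x /\ F x <= s) ->
  exists2 p, dom p & forall z, dom z -> F p <= F z.
Proof.
move=> [x0 x0dom] Fc mid clos.
pose A := F @` dom.
have A0 : A !=set0 by exists (F x0); exists x0.
have hA : has_inf A by split => //; exists c => _ [y yd <-]; exact: Fc.
set s := inf A.
have sF y : dom y -> s <= F y.
  by move=> yd; apply: ge_inf; [exact: hA.2 | exists y].
have /choice[u hu] : forall n : nat, exists y, dom y /\ F y < s + n.+1%:R^-1.
  move=> n; have [_ [y yd <-] Fy] := @inf_adherent _ A _ (gt0 (n.+1%:R^-1)%:pos) hA.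
  by exists y.
(* F is at least s at the point w given by [mid], so an eighth of the squared distance is at most
   the mean of the two excesses over s. *)
have uu n k : `|u n - u k| ^+ 2 <= 4 * (n.+1%:R^-1 + k.+1%:R^-1).
  have [w wd] := mid _ _ (hu n).1 (hu k).1.
  move: (sF _ wd) (hu n).2 (hu k).2.
  move: (n.+1%:R^-1) (k.+1%:R^-1) (`|_| ^+ 2) => a b d.
  lra.
have /cvg_ex[/= p up] : cvg (u @ \oo).
  apply: cauchy_cvg; apply: cauchy_exP => e e0.
  have e80 : 0 < e ^+ 2 / 8 by rewrite divr_gt0 ?exprn_gt0.
  have [N Ne] : exists N : nat, N.+1%:R^-1 < e ^+ 2 / 8.
    near \oo => N; exists N; near: N.
    exact: near_infty_natSinv_lt (PosNum e80).
  exists (u N); exists N => // n /= Nn.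
  rewrite -ball_normE /=.
  have : `|u N - u n| ^+ 2 < e ^+ 2.
    apply: le_lt_trans (uu _ _) _.
    have : n.+1%:R^-1 <= N.+1%:R^-1 :> R by rewrite lef_pV2 ?posrE// ler_nat.
    by move: Ne; move: (n.+1%:R^-1) (N.+1%:R^-1) => a b; lra.
  by rewrite ltr_pXn2r// ?nnegrE// ltW.
have [pd Fp] : dom p /\ F p <= s.
  apply: clos => e e0.
  near \oo => N; exists (u N); split; first exact: (hu N).1.
    near: N; move/cvgrPdist_lt : up; exact.
  apply: lt_trans (hu N).2 _; rewrite ltrD2l; near: N.
  exact: near_infty_natSinv_lt (PosNum e0).
by exists p => // z zd; apply: le_trans Fp (sF _ zd).
Unshelve. all: by end_near. Qed.

(** * Riesz representation and adjoints *)

(** The representer is the minimizer of |x|^2 / 2 - phi x: the derivative vanishes there in every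
    direction. *)
Lemma riesz_representation (R : realType) (X : hilbertType R) (phi : X -> R)
    (M : R) :
  (forall a x y, phi (a *: x + y) = a * phi x + phi y) ->
  (forall x, phi x <= M * `|x|) ->
  exists p, forall x, phi x = inner x p.
Proof.
move=> lin bnd.
have phi0 : phi 0 = 0.
  by have := lin 1 0 0; rewrite scale1r addr0 mul1r => /eqP; lra.
have phiD x y : phi (x + y) = phi x + phi y.
  by rewrite -[x in x + y]scale1r lin mul1r.
have phiZ a x : phi (a *: x) = a * phi x.
  by rewrite -[a *: x]addr0 lin phi0 addr0.
pose F x := 2^-1 * `|x| ^+ 2 - phi x.
have [||||p _ pmin] := @strongly_convex_min R X setT F (- (2^-1 * M ^+ 2)).
- by exists 0.
- move=> y _; rewrite /F; have := bnd y; have := sqr_ge0 (`|y| - M).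
  nra.
- move=> y z _ _; exists (2^-1 *: (y + z)) => //.
  by rewrite /F sqr_normZ phiZ phiD sqr_normD sqr_normB; lra.
- move=> x s h; split => //; apply/ler_addgt0Pr => e e0.
  (* Moving from y to x raises F by at most (|x| + |M|) |x - y|; the extra 1 absorbs the slack in F
     y < s + e / K. *)
  pose K := 1 + `|x| + `|M|.
  have K0 : 0 < K by have := normr_ge0 x; have := normr_ge0 M; rewrite /K; lra.
  have [y [_ xy Fy]] := h (e / K) (divr_gt0 e0 K0).
  move: xy Fy; have : e / K * K = e by rewrite divfK// gt_eqF.
  move: (e / K) => d dK xy.
  have -> : F y = F x + 2^-1 * `|x - y| ^+ 2 - inner x (x - y) + phi (x - y).
    rewrite /F -[y in phi y](subKr x) phiD -[- (x - y)]scaleN1r phiZ.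
    by rewrite -[y in `|y|](subKr x) sqr_normB; lra.
  have := inner_le x (x - y); have := bnd (y - x); rewrite distrC.
  rewrite -[y - x]opprB -scaleN1r phiZ.
  have := ler_norm M.
  move: (phi _) (inner _ _) => u w.
  have := normr_ge0 (x - y); have := normr_ge0 x; have := normr_ge0 M.
  rewrite /K in dK K0.
  move: xy; move: `|x - y| `|x| `|M| dK K0 => r a q dK K0.
  move=> rd q0 a0 r0 Mq uM wr Fs.
  have : 0 <= (d - r) * (a + q) by rewrite mulr_ge0; lra.
  have : 0 <= r * (q - M) by rewrite mulr_ge0; lra.
  nra.
exists p => x.
(* This is F (p + t x) - F p; positive and negative t give the two inequalities. *)
have key t : 0 <= t * (inner x p - phi x) + t ^+ 2 * (2^-1 * `|x| ^+ 2).
  have := pmin (t *: x + p) I.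
  by rewrite /F lin sqr_normD sqr_normZ innerZl; lra.
have le1 : phi x - inner x p <= 0.
  apply: (@le0_scale_limit _ _ (2^-1 * `|x| ^+ 2)) => t /andP[t0 t1].
  by rewrite -(ler_pM2l t0); have := key t; lra.
have le2 : inner x p - phi x <= 0.
  apply: (@le0_scale_limit _ _ (2^-1 * `|x| ^+ 2)) => t /andP[t0 t1].
  by rewrite -(ler_pM2l t0); have := key (- t); lra.
lra.
Qed.

(** Riesz representation of x |-> <A x, y> shows that the set from which [adjoint] chooses is
    nonempty. *)
Lemma adjointP (R : realType) (X Y : hilbertType R) (A : {linear X -> Y}) :
  bounded_operator A -> forall x y, inner (A x) y = inner x (adjoint A y).
Proof.
move=> [M AM] x y; rewrite /adjoint; case: xgetP => [_ -> /(_ x)//|].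
have [a u w|u|z zP /(_ z)[]//] :=
  @riesz_representation R X (fun u => inner (A u) y) (M * `|y|).
  by rewrite linearP innerDZl.
by apply: le_trans (inner_le _ _) _; rewrite mulrAC ler_wpM2r.
Qed.

Lemma adjoint_linear (R : realType) (X Y : hilbertType R) (A : {linear X -> Y}) :
  bounded_operator A ->
  forall a x y, adjoint A (a *: x + y) = a *: adjoint A x + adjoint A y.
Proof.
move=> bA a x y; apply: inner_ext => z.
by rewrite -adjointP// !(innerDr, innerZr) -!adjointP.
Qed.

Lemma adjoint_bounded (R : realType) (X Y : hilbertType R) (A : {linear X -> Y}) :
  bounded_operator A -> bounded_operator (adjoint A).
Proof.
move=> bA; have [M AM] := bA; exists `|M| => y.
have : `|adjoint A y| ^+ 2 <= `|M| * `|adjoint A y| * `|y|.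
  rewrite -innerxx -adjointP//; apply: le_trans (inner_le _ _) _.
  by rewrite ler_wpM2r// (le_trans (AM _))// ler_wpM2r// ler_norm.
have [->|ne] := eqVneq (adjoint A y) 0; first by rewrite normr0 mulr_ge0.
have p : 0 < `|adjoint A y| by rewrite normr_gt0.
by rewrite expr2 mulrAC ler_pM2r.
Qed.

Lemma compact_operator_bounded (R : realType) (X Y : hilbertType R)
    (A : {linear X -> Y}) :
  compact_operator A -> bounded_operator A.
Proof.
rewrite /compact_operator precompactE => /compact_bounded[M [_ /(_ (`|M| + 1))]].
move=> /(_ ltac:(by rewrite (le_lt_trans (ler_norm M))// ltrDl)) h.
exists (`|M| + 1) => x; have [->|x0] := eqVneq x 0.
  by rewrite linear0 !normr0 mulr0.
have nx : 0 < `|x| by rewrite normr_gt0.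
have := h (A (`|x|^-1 *: x)); rewrite linearZ /= normrZ normfV normr_id.
rewrite ler_pdivrMl// [_ * (_ + _)]mulrC; apply.
apply: subset_closure; exists (`|x|^-1 *: x); last by rewrite linearZ.
by rewrite /= normrZ normfV normr_id mulVf// gt_eqF.
Qed.

(** * Proximity operators *)

(* A proper lower semicontinuous convex function to ]-oo, +oo], given by its
   domain and its restriction to it. *)
Definition closed_convex (R : realType) (X : hilbertType R) (dom : set X)
    (f : X -> R) : Prop :=
  [/\ dom !=set0,
      forall (t : R) x y, 0 < t < 1 -> dom x -> dom y ->
        dom (t *: x + (1 - t) *: y) /\
        f (t *: x + (1 - t) *: y) <= t * f x + (1 - t) * f y
    & forall x a, (dom x -> a < f x) ->
        exists2 e : R, 0 < e & forall y, `|x - y| < e -> dom y -> a < f y].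

Lemma closed_convex_scale (R : realType) (X : hilbertType R) (dom : set X)
    (f : X -> R) (c : R) :
  0 < c -> closed_convex dom f -> closed_convex dom (fun x => c * f x).
Proof.
move=> c0 [dom0 conv lsc]; split=> //.
- move=> t x y t01 dx dy; have [dz fz] := conv t x y t01 dx dy; split=> //.
  by rewrite mulrCA [_ * (c * _)]mulrCA -mulrDr ler_pM2l.
- move=> x a ax; have [|e e0 he] := lsc x (a / c).
    by move=> dx; rewrite ltr_pdivrMr// mulrC ax.
  by exists e => // y xy dy; rewrite mulrC -ltr_pdivrMr// he.
Qed.

(** As g never takes the value -oo, [fine] loses nothing on the domain; convexity keeps segments
    inside it because the right-hand side is finite there. *)
Lemma closed_convex_fine (R : realType) (X : hilbertType R) (g : X -> \bar R) :
  proper_function g -> lower_semicontinuous g -> convex_ereal g ->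
  closed_convex [set x | g x != +oo%E] (fun x => fine (g x)).
Proof.
move=> [gN [x0 gx0]] lsc conv.
have gE x : g x != +oo%E -> g x = (fine (g x))%:E.
  by move=> gx; rewrite fineK// fin_numE gN gx.
split; first by exists x0.
- move=> t x y t01 /= gx gy; have := conv t x y t01.
  rewrite (gE _ gx) (gE _ gy) -!EFinM -EFinD => le.
  have gz : g (t *: x + (1 - t) *: y) != +oo%E.
    by apply/eqP => gz; move: le; rewrite gz leye_eq.
  by split=> //; move: le; rewrite (gE _ gz) lee_fin.
- move=> x a ax; have [|V /nbhs_ballP[e /= e0 eV] gV] := lsc x a.
    have [->|gx] := eqVneq (g x) +oo%E; first by rewrite ltry.
    by rewrite (gE _ gx) lte_fin ax.
  exists e => // y xy gy; have := gV y; rewrite (gE _ gy) lte_fin; apply.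
  by apply: eV; rewrite -ball_normE.
Qed.

(** A conical minorant, obtained without separation theorems. Semicontinuity bounds f below on a
    ball around x0; a far point y is compared, by convexity, with a point of the segment [x0, y]
    inside that ball. *)
Lemma closed_convex_lower_bound (R : realType) (X : hilbertType R)
    (dom : set X) (f : X -> R) :
  closed_convex dom f ->
  exists x0 (C K : R), 0 <= K /\ forall y, dom y -> C - K * `|y - x0| <= f y.
Proof.
move=> [[x0 dx0] conv lsc].
have [|d d0 hd] := lsc x0 (f x0 - 1); first by rewrite ltrBlDr ltrDl.
exists x0, (f x0 - 1), (2 / d).
have K0 : 0 < 2 / d by rewrite divr_gt0.
split=> [|y dy]; first exact: ltW.
have [close|far] := ltP `|y - x0| d.
  have := hd y; rewrite distrC => /(_ close dy).
  have : 0 <= 2 / d * `|y - x0| by rewrite mulr_ge0// ltW.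
  lra.
have r0 : 0 < `|y - x0| by apply: lt_le_trans far.
(* Puts the comparison point at distance d / 2 from x0. Convexity then gives f y >= f x0 - 1 / t,
   and 1 / t is the slope 2 / d times |y - x0|. *)
pose t := d / (2 * `|y - x0|).
have rt : t * `|y - x0| = d / 2.
  by rewrite /t invfM mulrA divfK// gt_eqF.
have t0 : 0 < t by rewrite divr_gt0// mulr_gt0.
have t1 : t < 1 by nra.
have t01 : 0 < t < 1 by rewrite t0.
have [dz fz] := conv t y x0 t01 dy dx0.
have : f x0 - 1 < f (t *: y + (1 - t) *: x0).
  apply: hd => //.
  have -> : x0 - (t *: y + (1 - t) *: x0) = - (t *: (y - x0)).
    by vector_field.
  by rewrite normrN normrZ gtr0_norm// rt; lra.
have kt : t * (2 / d * `|y - x0|) = 1.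
  by rewrite mulrCA rt mulf_div [d * 2]mulrC divff// gt_eqF// mulr_gt0.
rewrite -(ler_pM2l t0) mulrBr kt; lra.
Qed.

(** The quadratic term makes the objective strongly convex, so a minimizer exists and the choice in
    [prox] succeeds. The inequality is the optimality condition along segments from the
    minimizer. *)
Lemma prox_variational (R : realType) (X : hilbertType R) (dom : set X)
    (f : X -> R) (h : X -> \bar R) (x : X) :
  closed_convex dom f ->
  (forall y, dom y -> h y = (f y)%:E) -> (forall y, ~ dom y -> h y = +oo%E) ->
  dom (prox h x) /\ forall z, dom z ->
    inner (x - prox h x) (z - prox h x) + f (prox h x) <= f z.
Proof.
move=> cc hE hoo; have [[x1 dx1] conv lsc] := cc.
have [x0 [C [K [K0 low]]]] := closed_convex_lower_bound cc.
pose F y := f y + 2^-1 * `|x - y| ^+ 2.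
have mid (y z : X) : 2^-1 *: y + (1 - 2^-1) *: z = 2^-1 *: (y + z).
  by vector_field.
have [||||p dp pmin] := @strongly_convex_min R X dom F
    (* With r = |x - y|, the conical minorant leaves r^2 / 2 - K r, which is at least - K^2 / 2. *)
    (C - K * `|x - x0| - 2^-1 * K ^+ 2).
- by exists x1.
- move=> y dy; rewrite /F; have := low y dy.
  have := ler_distD x y x0; rewrite [`|y - x|]distrC.
  have := sqr_ge0 (`|x - y| - K); nra.
- move=> y z dy dz; have [|dw fw] := conv 2^-1 y z _ dy dz; first lra.
  exists (2^-1 *: y + (1 - 2^-1) *: z) => //.
  apply: (le_trans (lerD fw (lexx _))); rewrite mid.
  have -> : x - 2^-1 *: (y + z) = 2^-1 *: ((x - y) + (x - z)).
    by vector_field.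
  have -> : y - z = (x - z) - (x - y) by vector_field.
  rewrite /F sqr_normZ; move: (x - y) (x - z) => a b.
  by rewrite sqr_normD sqr_normB (innerC b a); lra.
- move=> x2 s hs.
  suff H : dom x2 /\ f x2 <= s - 2^-1 * `|x - x2| ^+ 2.
    by split; [exact: H.1 | rewrite /F; lra].
  apply: contrapT => nH.
  (* A threshold a separates f x2 from the claimed bound; outside [dom], where f counts as +oo, any
     larger a will do. Near x2 the values of f exceed a, which will contradict F y being close to
     s. *)
  have [a fa ax] : exists2 a, (dom x2 -> a < f x2) &
      s - 2^-1 * `|x - x2| ^+ 2 < a.
    have [dx2|ndx2] := pselect (dom x2); last first.
      by exists (s - 2^-1 * `|x - x2| ^+ 2 + 1); [by [] | rewrite ltrDl].
    have lt : s - 2^-1 * `|x - x2| ^+ 2 < f x2.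
      by rewrite ltNge; apply/negP => le; apply: nH.
    exists (2^-1 * (f x2 + (s - 2^-1 * `|x - x2| ^+ 2))); lra.
  have [e e0 he] := lsc x2 a fa.
  pose b := a - (s - 2^-1 * `|x - x2| ^+ 2).
  have b0 : 0 < b by rewrite subr_gt0.
  have q0 : 0 < 1 + `|x - x2| by rewrite ltr_wpDr.
  (* The quadratic term drops by at most |x - x2| |x2 - y| between x2 and y. Together with the slack
     in F y this stays below the gap b. *)
  have e1 : 0 < Num.min e (b / (1 + `|x - x2|)) by rewrite lt_min e0 divr_gt0.
  have [y [dy xy Fy]] := hs _ e1.
  have fy : a < f y by apply: he dy; apply: lt_le_trans xy _; rewrite ge_min lexx.
  have xyb : `|x2 - y| < b / (1 + `|x - x2|).
    by apply: lt_le_trans xy _; rewrite ge_min lexx orbT.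
  have Fyb : F y < s + b / (1 + `|x - x2|).
    by apply: lt_le_trans Fy _; rewrite lerD2l ge_min lexx orbT.
  move: xyb Fyb; have : b / (1 + `|x - x2|) * (1 + `|x - x2|) = b.
    by rewrite divfK// gt_eqF.
  move: (b / _) => d db xyd; rewrite /F.
  have := ler_distD y x x2; rewrite [`|y - x2|]distrC.
  have := normr_ge0 (x - y); have := normr_ge0 (x2 - y).
  have := normr_ge0 (x - x2).
  move: fy; rewrite /b in db.
  move: db xyd; move: `|x - y| `|x - x2| `|x2 - y| => u w r.
  move=> db rd fy w0 r0 u0 wur Fs.
  have : 0 <= (d - r) * w by rewrite mulr_ge0; lra.
  have [|] := leP w r; nra.
(* Whatever minimizer is chosen lies in [dom], since its value is bounded by the finite one at p. *)
have proxE : dom (prox h x) /\ forall z, dom z -> F (prox h x) <= F z.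
  rewrite /prox; case: xgetP => [q _ qmin|/(_ p)[]].
    have dq : dom q.
      apply: contrapT => ndq; have := qmin p.
      by rewrite (hoo _ ndq) (hE _ dp) -EFinD /= leye_eq.
    split=> // z dz; have := qmin z.
    by rewrite (hE _ dq) (hE _ dz) -!EFinD lee_fin.
  move=> z; have [dz|ndz] := pselect (dom z).
    by rewrite (hE _ dp) (hE _ dz) -!EFinD lee_fin; exact: pmin.
  by rewrite (hoo _ ndz) /= leey.
move: (prox h x) proxE => q [dq qmin]; split=> // z dz.
rewrite -subr_le0; apply: (@le0_scale_limit _ _ (2^-1 * `|z - q| ^+ 2)).
move=> t /[dup] t01 /andP[t0 t1].
have [dw fw] := conv t z q t01 dz dq.
have := qmin _ dw; rewrite /F.
have -> : x - (t *: z + (1 - t) *: q) = (x - q) - t *: (z - q).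
  by vector_field.
rewrite [X in _ <= _ + _ * X]sqr_normB sqr_normZ innerZr -(ler_pM2l t0 (_ - _)).
nra.
Qed.

(** Adding the variational inequalities at x and y, each tested at the other's image, gives firm
    nonexpansiveness |p - q|^2 <= <x - y, p - q>. Expanding the square of 2 (p - q) - (x - y) turns
    it into the claim. *)
Lemma prox_reflection_nonexpansive (R : realType) (X : hilbertType R)
    (dom : set X) (f : X -> R) (h : X -> \bar R) (x y : X) :
  closed_convex dom f ->
  (forall y, dom y -> h y = (f y)%:E) -> (forall y, ~ dom y -> h y = +oo%E) ->
  `|(2 *: prox h x - x) - (2 *: prox h y - y)| <= `|x - y|.
Proof.
move=> cc hE hoo.
have [dp vp] := prox_variational x cc hE hoo.
have [dq vq] := prox_variational y cc hE hoo.
move: (prox h x) (prox h y) dp vp dq vq => p q dp vp dq vq.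
have {vp vq} key : `|p - q| ^+ 2 <= inner (x - y) (p - q).
  move: (vp q dq) (vq p dp); rewrite -innerxx !(innerDl, innerDr, innerNl, innerNr).
  by rewrite (innerC q p); lra.
rewrite -(@ler_pXn2r _ 2)// ?nnegrE//.
have -> : 2 *: p - x - (2 *: q - y) = 2 *: (p - q) - (x - y).
  by vector_field.
by rewrite sqr_normB sqr_normZ innerZl (innerC (p - q)); lra.
Qed.

(** * Triangular operators on the product space *)

Lemma orthonormal_span_norm (R : realType) (X : hilbertType R) (v : nat -> X)
    (c : nat -> R) (n : nat) :
  (forall p q, inner (v p) (v q) = (p == q)%:R) ->
  `|\sum_(p < n) c p *: v p| ^+ 2 = \sum_(p < n) c p ^+ 2.
Proof.
move=> ortho.
have orth0 q k : (k <= q)%N -> inner (\sum_(p < k) c p *: v p) (v q) = 0.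
  elim: k => [|k IH] kq; first by rewrite big_ord0 inner0l.
  rewrite big_ord_recr /= innerDl innerZl ortho IH; last exact: ltnW.
  by rewrite ltn_eqF// mulr0 addr0.
elim: n => [|n IH]; first by rewrite !big_ord0 normr0 expr0n.
rewrite !big_ord_recr /= sqr_normD innerZr orth0// !mulr0 addr0 IH.
by rewrite sqr_normZ -innerxx ortho eqxx mulr1.
Qed.

Lemma span_widen (R : realType) (X : hilbertType R) (v : nat -> X)
    (c : nat -> R) (n k : nat) : (n <= k)%N ->
  exists c' : nat -> R, \sum_(p < n) c p *: v p = \sum_(p < k) c' p *: v p.
Proof.
move=> nk; exists (fun p => if (p < n)%N then c p else 0).
rewrite (big_ord_widen k (fun p => c p *: v p) nk) big_mkcond.
by apply: eq_bigr => p _; case: ifP => // _; rewrite scale0r.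
Qed.

Lemma sqr_prod_norm (R : realType) (X : normedModType R) (z : X * X) :
  prod_norm z ^+ 2 = `|z.1| ^+ 2 + `|z.2| ^+ 2.
Proof. by rewrite /prod_norm sqr_sqrtr// addr_ge0. Qed.

Lemma prod_norm_ge0 (R : realType) (X : normedModType R) (z : X * X) :
  0 <= prod_norm z.
Proof. exact: sqrtr_ge0. Qed.

Lemma prod_normZ (R : realType) (X : normedModType R) (c : R) (z : X * X) :
  prod_norm (c *: z) = `|c| * prod_norm z.
Proof.
rewrite /prod_norm /= !normrZ !exprMn -mulrDr sqrtrM ?sqr_ge0//.
by rewrite sqrtr_sqr normr_id.
Qed.

Lemma prod_normD (R : realType) (X : normedModType R) (z w : X * X) :
  prod_norm (z + w) <= prod_norm z + prod_norm w.
Proof.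
rewrite -(@ler_pXn2r _ 2)// ?nnegrE ?addr_ge0 ?prod_norm_ge0//.
rewrite sqr_prod_norm sqrrD !sqr_prod_norm /=.
have le1 : `|z.1 + w.1| ^+ 2 <= (`|z.1| + `|w.1|) ^+ 2.
  by rewrite lerXn2r ?nnegrE ?addr_ge0 ?ler_normD.
have le2 : `|z.2 + w.2| ^+ 2 <= (`|z.2| + `|w.2|) ^+ 2.
  by rewrite lerXn2r ?nnegrE ?addr_ge0 ?ler_normD.
(* Cauchy-Schwarz in the plane: the squares of the two sides differ by a perfect square. *)
have le3 : `|z.1| * `|w.1| + `|z.2| * `|w.2| <= prod_norm z * prod_norm w.
  rewrite -(@ler_pXn2r _ 2)// ?nnegrE ?addr_ge0 ?mulr_ge0 ?prod_norm_ge0//.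
  rewrite exprMn !sqr_prod_norm.
  by have := sqr_ge0 (`|z.1| * `|w.2| - `|z.2| * `|w.1|); nra.
rewrite mulr2n; nra.
Qed.

Lemma prod_norm_le_add (R : realType) (X : normedModType R) (z : X * X) :
  prod_norm z <= `|z.1| + `|z.2|.
Proof.
rewrite -(@ler_pXn2r _ 2)// ?nnegrE ?addr_ge0 ?prod_norm_ge0//.
by rewrite sqr_prod_norm sqrrD mulr2n;
  have := normr_ge0 z.1; have := normr_ge0 z.2; nra.
Qed.

Lemma prod_norm_ge_comp (R : realType) (X : normedModType R) (z : X * X) :
  `|z.1| <= prod_norm z /\ `|z.2| <= prod_norm z.
Proof.
by split; rewrite -(@ler_pXn2r _ 2)// ?nnegrE ?prod_norm_ge0// sqr_prod_norm
  ?lerDl ?lerDr sqr_ge0.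
Qed.

Lemma span_pair_dense (R : realType) (X : hilbertType R) (v : nat -> X)
    (z : X * X) (e : R) : orthonormal_basis v -> 0 < e ->
  exists n (x b : nat -> R), prod_norm
    (z - (\sum_(p < n) x p *: v p, \sum_(p < n) b p *: v p)) < e.
Proof.
move=> [_ dense] e0.
have approx x : exists n (c : nat -> R), `|x - \sum_(p < n) c p *: v p| < e / 2.
  have e20 : 0 < e / 2 by lra.
  have : [set: X] x by [].
  rewrite -dense => /(_ _ (nbhsx_ballx x _ e20))[_ [[n [c ->]]]].
  by rewrite -ball_normE; exists n, c.
have [n1 [c1 h1]] := approx z.1; have [n2 [c2 h2]] := approx z.2.
have [x xE] := span_widen v c1 (leq_maxl n1 n2).
have [b bE] := span_widen v c2 (leq_maxr n1 n2).
exists (maxn n1 n2), x, b; rewrite -xE -bE.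
by apply: le_lt_trans (prod_norm_le_add _) _ => /=; lra.
Qed.

(* The bound is the largest eigenvalue of [A^T A] for [A = [[B, K], [0, E]]]. *)
Lemma triangular_quadratic_bound (R : realType) (B K E c x y : R) :
  c = B ^+ 2 + K ^+ 2 + E ^+ 2 ->
  (B * x + K * y) ^+ 2 + (E * y) ^+ 2 <=
  2^-1 * (c + Num.sqrt (c ^+ 2 - 4 * B ^+ 2 * E ^+ 2)) * (x ^+ 2 + y ^+ 2).
Proof.
move=> cE.
have disc : 0 <= c ^+ 2 - 4 * B ^+ 2 * E ^+ 2.
  have -> : c ^+ 2 - 4 * B ^+ 2 * E ^+ 2 =
    ((B - E) ^+ 2 + K ^+ 2) * ((B + E) ^+ 2 + K ^+ 2) by rewrite cE; ring.
  by rewrite mulr_ge0// addr_ge0// sqr_ge0.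
have := sqr_sqrtr disc; have := sqrtr_ge0 (c ^+ 2 - 4 * B ^+ 2 * E ^+ 2).
move: (Num.sqrt _) => s s0 s2.
(* u and w are the diagonal entries of lambda - A^T A, with lambda = (c + s) / 2 and off-diagonal
   entry - B K. The determinant is 0 and the trace is s >= 0, so this matrix is positive
   semidefinite. *)
pose u := 2^-1 * (c + s) - B ^+ 2.
pose w := 2^-1 * (c + s) - K ^+ 2 - E ^+ 2.
have uw : u * w = (B * K) ^+ 2.
  have -> : u * w = 4^-1 * (s ^+ 2 - (B ^+ 2 - K ^+ 2 - E ^+ 2) ^+ 2).
    by rewrite /u /w cE; field.
  by rewrite s2 cE; field.
have uws : u + w = s by rewrite /u /w cE; field.
have uw0 : 0 <= u * w by rewrite uw sqr_ge0.
have u0 : 0 <= u by nra.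
have w0 : 0 <= w by nra.
suff : 0 <= u * x ^+ 2 - 2 * (B * K) * x * y + w * y ^+ 2 by rewrite /u /w; lra.
have [u00|une] := eqVneq u 0.
  have /eqP BK0 : (B * K) ^+ 2 == 0 by rewrite -uw u00 mul0r.
  have -> : B * K = 0 by apply/eqP; rewrite -sqrf_eq0 BK0.
  rewrite u00; have := mulr_ge0 w0 (sqr_ge0 y); lra.
have up : 0 < u by rewrite lt_neqAle eq_sym une.
rewrite -(pmulr_rge0 _ up).
have -> : u * (u * x ^+ 2 - 2 * (B * K) * x * y + w * y ^+ 2) =
  (u * x - B * K * y) ^+ 2 + (u * w - (B * K) ^+ 2) * y ^+ 2 by ring.
by rewrite uw subrr mul0r addr0 sqr_ge0.
Qed.

Definition prod_bounded (R : realType) (X : normedModType R)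
    (A : X * X -> X * X) : Prop :=
  exists2 M : R, 0 <= M & forall z, prod_norm (A z) <= M * prod_norm z.

(** The supremum over p of the squared spectral norm of [[B p, K p], [0, E]]. Both [a_const] and
    [b_const] are instances. *)
Definition triangular_sup (R : realType) (B K : nat -> R) (E : R) : R :=
  2^-1 * sup (range (fun p =>
    let c := B p ^+ 2 + K p ^+ 2 + E ^+ 2 in
    c + Num.sqrt (c ^+ 2 - 4 * B p ^+ 2 * E ^+ 2))).

(** The invariant planes are mutually orthogonal, so the blockwise bounds add up on finite spans,
    and density extends the result. The a priori bound M serves twice: to make the supremum one of a
    bounded set, and to pass to the limit. *)
Lemma triangular_norm_bound (R : realType) (X : hilbertType R) (v : nat -> X)
    (A : X * X -> X * X) (B K : nat -> R) (E : R) :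
  orthonormal_basis v ->
  (forall c z w, A (c *: z + w) = c *: A z + A w) -> prod_bounded A ->
  (forall p x b, A (x *: v p, b *: v p) =
     ((B p * x + K p * b) *: v p, (E * b) *: v p)) ->
  forall z, prod_norm (A z) <= Num.sqrt (triangular_sup B K E) * prod_norm z.
Proof.
move=> hv lin [M M0 AM] eig.
have [ortho _] := hv.
have AD z w : A (z + w) = A z + A w.
  by rewrite -[z in z + w]scale1r lin scale1r.
have A0 : A 0 = 0 by apply: (addrI (A 0)); rewrite -AD !addr0.
have nv p : `|v p| ^+ 2 = 1 by rewrite -innerxx ortho eqxx.
(* Evaluating A at (v_p, 0) and (0, v_p) bounds the two columns. Without such a bound, [sup] could
   be a default value. *)
have coef p : B p ^+ 2 <= M ^+ 2 /\ K p ^+ 2 + E ^+ 2 <= M ^+ 2.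
  have sq z : prod_norm (A z) ^+ 2 <= M ^+ 2 * prod_norm z ^+ 2.
    by rewrite -exprMn lerXn2r ?nnegrE ?mulr_ge0 ?prod_norm_ge0.
  split.
    have := sq (1 *: v p, 0 *: v p); rewrite eig !sqr_prod_norm /= !sqr_normZ nv.
    by lra.
  have := sq (0 *: v p, 1 *: v p); rewrite eig !sqr_prod_norm /= !sqr_normZ nv.
  by lra.
pose G p := let c := B p ^+ 2 + K p ^+ 2 + E ^+ 2 in
    c + Num.sqrt (c ^+ 2 - 4 * B p ^+ 2 * E ^+ 2).
have Gub p : G p <= 4 * M ^+ 2.
  have [c1 c2] := coef p; rewrite /G /=.
  set c := _ + _ + E ^+ 2.
  have c0 : 0 <= c by rewrite !addr_ge0 ?sqr_ge0.
  have : Num.sqrt (c ^+ 2 - 4 * B p ^+ 2 * E ^+ 2) <= c.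
    rewrite -[leRHS](ger0_norm c0) -sqrtr_sqr.
    by rewrite ler_wsqrtr// gerBl -mulrA mulr_ge0// mulr_ge0// sqr_ge0.
  by rewrite /c; lra.
have Gsup p : 2^-1 * G p <= triangular_sup B K E.
  rewrite ler_pM2l ?invr_gt0//; apply: ub_le_sup; last by exists p.
  by exists (4 * M ^+ 2) => _ [q _ <-]; exact: Gub.
set S := triangular_sup B K E.
have S0 : 0 <= S.
  apply: le_trans (Gsup 0%N); rewrite mulr_ge0// addr_ge0 ?sqrtr_ge0//.
  by rewrite !addr_ge0 ?sqr_ge0.
have finite n (x b : nat -> R) :
  prod_norm (A (\sum_(p < n) x p *: v p, \sum_(p < n) b p *: v p))
  <= Num.sqrt S * prod_norm (\sum_(p < n) x p *: v p, \sum_(p < n) b p *: v p).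
  have -> : A (\sum_(p < n) x p *: v p, \sum_(p < n) b p *: v p) =
     (\sum_(p < n) (B p * x p + K p * b p) *: v p, \sum_(p < n) (E * b p) *: v p).
    elim: n => [|n IH]; first by rewrite !big_ord0 A0.
    rewrite !big_ord_recr /=.
    by rewrite -[LHS]/(A ((_, _) + (_, _))) AD IH eig.
  rewrite -(@ler_pXn2r _ 2)// ?nnegrE ?mulr_ge0 ?prod_norm_ge0 ?sqrtr_ge0//.
  rewrite exprMn (sqr_sqrtr S0) !sqr_prod_norm /=
    (orthonormal_span_norm (fun p => B p * x p + K p * b p))//
    (orthonormal_span_norm (fun p => E * b p))// !orthonormal_span_norm//.
  rewrite -!big_split mulr_sumr; apply: ler_sum => p _ /=.
  apply: le_trans (triangular_quadratic_bound _ _ erefl) _.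
  apply: ler_wpM2r; first by rewrite addr_ge0 ?sqr_ge0.
  exact: Gsup.
move=> z; apply/ler_addgt0Pr => e e0.
(* Replacing z by w costs at most sqrt S + M times their distance. *)
pose C := Num.sqrt S + M + 1.
have sS := sqrtr_ge0 S.
have C0 : 0 < C by rewrite /C; lra.
have [n [x [b]]] := span_pair_dense z hv (divr_gt0 e0 C0).
set w := (_, _) => zw.
have zE : A z = A w + A (z - w) by rewrite -AD addrC subrK.
have le1 : prod_norm (A z) <= prod_norm (A w) + prod_norm (A (z - w)).
  by rewrite zE prod_normD.
have le2 := finite n x b; rewrite -/w in le2.
have le3 := AM (z - w).
have le4 : prod_norm w <= prod_norm z + prod_norm (z - w).
  have := prod_normD z (w - z); rewrite subrKC.
  by rewrite -opprB -scaleN1r prod_normZ normrN1 mul1r.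
have dC : e / C * C = e by rewrite divfK// gt_eqF.
have := prod_norm_ge0 (z - w); move: zw dC; rewrite /C.
move: (e / _) (prod_norm (z - w)) le1 le3 le4 => d r le1 le3 le4 rd dC r0.
have : 0 <= (d - r) * (Num.sqrt S + M) by rewrite mulr_ge0; lra.
have : 0 <= Num.sqrt S * (prod_norm z + r - prod_norm w) by rewrite mulr_ge0; lra.
nra.
Qed.

(** * Averagedness of a network of firmly nonexpansive layers *)

(** The value for i > n is the identity, so that in the unrolled sums the most recent perturbation
    carries the empty composition. *)
Fixpoint layer_comp (V : Type) (U : nat -> V -> V) (i n : nat) : V -> V :=
  if n is n'.+1 then
    if (i <= n)%N then U n \o layer_comp U i n' else id
  else id.

Lemma layer_comp_id (V : Type) (U : nat -> V -> V) (n : nat) :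
  layer_comp U n.+1 n = id.
Proof. by case: n => //= n; rewrite ltnn. Qed.

Lemma layer_compS (V : Type) (U : nat -> V -> V) (i n : nat) :
  (i <= n.+1)%N -> layer_comp U i n.+1 = U n.+1 \o layer_comp U i n.
Proof. by move=> /= ->. Qed.

(** Discrete variation of constants. The second formula is kept apart because the next perturbation
    will be estimated by U (d n), before it is added. *)
Lemma unrolled_recurrence (R : realType) (V : lmodType R) (U : nat -> V -> V)
    (m : nat) (d e : nat -> V) :
  (forall n x y, U n (x + y) = U n x + U n y) ->
  (forall n, (n < m)%N -> d n.+1 = U n.+1 (d n) + e n.+1) ->
  (forall n, (n <= m)%N -> d n = layer_comp U 1 n (d 0%N)
     + \sum_(1 <= j < n.+1) layer_comp U j.+1 n (e j)) /\
  (forall n, (n < m)%N -> U n.+1 (d n) = layer_comp U 1 n.+1 (d 0%N)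
     + \sum_(1 <= j < n.+1) layer_comp U j.+1 n.+1 (e j)).
Proof.
move=> UD dS.
have U0 n : U n 0 = 0 by apply: (addrI (U n 0)); rewrite -UD !addr0.
have step n : d n = layer_comp U 1 n (d 0%N)
      + \sum_(1 <= j < n.+1) layer_comp U j.+1 n (e j) ->
    U n.+1 (d n) = layer_comp U 1 n.+1 (d 0%N)
      + \sum_(1 <= j < n.+1) layer_comp U j.+1 n.+1 (e j).
  move=> dE; rewrite {1}dE UD layer_compS//; congr (_ + _).
  rewrite (big_morph (U n.+1) (UD n.+1) (U0 n.+1)).
  by apply: eq_big_nat => j /andP[_ jn]; rewrite layer_compS.
have dE n : (n <= m)%N -> d n = layer_comp U 1 n (d 0%N)
    + \sum_(1 <= j < n.+1) layer_comp U j.+1 n (e j).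
  elim: n => [_|n IH nm]; first by rewrite big_geq// addr0.
  rewrite dS// step; last by apply: IH; exact: ltnW.
  by rewrite [in RHS]big_nat_recr// layer_comp_id addrA.
by split=> // n nm; apply: step; apply: dE; exact: ltnW.
Qed.

(** Aligns the recursion for theta with the unrolled sum: the first term belongs to the initial
    difference, and the perturbation e j meets layers j + 1 onwards. *)
Lemma theta_split (R : realType) (theta a : nat -> R) (n : nat) :
  theta 0%N = 1 ->
  \sum_(1 <= i < n.+2) theta i.-1 * a i =
  a 1%N + \sum_(1 <= j < n.+1) theta j * a j.+1.
Proof. by move=> t0; rewrite big_ltn// t0 mul1r big_add1. Qed.

Lemma seminorm_sum (R : realType) (V : lmodType R) (N : V -> R)
    (F : nat -> V) (B : nat -> R) (m n : nat) :
  N 0 = 0 -> (forall x y, N (x + y) <= N x + N y) ->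
  (forall j, (m <= j < n)%N -> N (F j) <= B j) ->
  N (\sum_(m <= j < n) F j) <= \sum_(m <= j < n) B j.
Proof.
move=> N0 ND FB; rewrite big_nat [leRHS]big_nat.
elim/big_ind2: _ => [|x1 x2 y1 y2 h1 h2|j jn]; first by rewrite N0.
  by rewrite (le_trans (ND _ _))// lerD.
exact: FB.
Qed.

(** The spectral data enter only through the operator bounds [a] and [b], and P n is the reflection
    of which layer n takes the half-sum with the identity. *)
Lemma network_averaged (R : realType) (V : lmodType R) (N : V -> R)
    (U P S : nat -> V -> V) (a : nat -> nat -> R) (theta : nat -> R)
    (m : nat) (b alpha : R) :
  (0 < m)%N -> 2^-1 <= alpha ->
  (forall x y, N (x + y) <= N x + N y) ->
  (forall c x, N (c *: x) = `|c| * N x) ->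
  (forall n c x y, U n (c *: x + y) = c *: U n x + U n y) ->
  (forall n x y, (1 <= n <= m)%N -> N (P n x - P n y) <= N (x - y)) ->
  S 0%N = id ->
  (forall n z, S n.+1 z = 2^-1 *: (U n.+1 (S n z) + P n.+1 (U n.+1 (S n z)))) ->
  (forall i n, 0 <= a i n) ->
  (forall i n x, (1 <= i <= n)%N -> (n <= m)%N ->
     N (layer_comp U i n x) <= a i n * N x) ->
  (forall x, N (layer_comp U 1 m x - (2 ^+ m * (1 - alpha)) *: x) <= b * N x) ->
  theta 0%N = 1 ->
  (forall n, (1 <= n <= m)%N ->
     theta n = \sum_(1 <= i < n.+1) theta i.-1 * a i n) ->
  b - a 1%N m <= 2 ^+ m * alpha - 2 * theta m ->
  averaged N alpha (S m).
Proof.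
move=> m0 al ND NZ UL Pn S0 SS a0 La Lb th0 th hb.
have al0 : 0 < alpha by lra.
have N0 : N 0 = 0 by rewrite -(scale0r 0) NZ normr0 mul0r.
have UD n x y : U n (x + y) = U n x + U n y.
  by rewrite -[x in x + y]scale1r UL scale1r.
have U0 n : U n 0 = 0 by apply: (addrI (U n 0)); rewrite -UD !addr0.
have UZ n c x : U n (c *: x) = c *: U n x.
  by rewrite -[c *: x]addr0 UL U0 addr0.
have UB n x y : U n (x - y) = U n x - U n y.
  by rewrite UD -scaleN1r UZ scaleN1r.
(* Solving the definition of averagedness for its nonexpansive part gives (S - (1 - alpha) Id) /
   alpha. *)
suff main x y :
    N ((S m x - S m y) - (1 - alpha) *: (x - y)) <= alpha * N (x - y).
  exists (fun x => alpha^-1 *: (S m x - (1 - alpha) *: x)); split=> [x y|x].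
    rewrite -scalerBr NZ gtr0_norm ?invr_gt0// ler_pdivrMl//.
    apply: le_trans (main x y); rewrite scalerBr.
    by rewrite !opprB addrACA [- _ + _]addrC addrACA.
  by rewrite scalerA divff ?gt_eqF// scale1r addrC subrK.
(* The powers of 2 absorb the factor 1/2 of each layer; the exponent n - 1 in e n makes it
   comparable with U n (d n.-1). *)
pose d n := 2 ^+ n *: (S n x - S n y).
pose e n := 2 ^+ n.-1 *: (P n (U n (S n.-1 x)) - P n (U n (S n.-1 y))).
have dS n : (n < m)%N -> d n.+1 = U n.+1 (d n) + e n.+1.
  move=> _; rewrite /d /e /= UZ UB !SS -scalerDr -scalerBr exprS scalerA.
  by rewrite mulrAC divff ?mul1r// opprD addrACA.
have eU n : (n < m)%N -> N (e n.+1) <= N (U n.+1 (d n)).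
  by move=> nm; rewrite /e /d UZ UB !NZ ler_wpM2l// Pn.
have [dE UdE] := unrolled_recurrence UD dS.
have Nd0 : 0 <= N (d 0%N).
  have := ND (d 0%N) (- d 0%N); rewrite subrr N0 -scaleN1r (NZ (-1)) normrN1; lra.
have eth n : (1 <= n <= m)%N -> N (e n) <= theta n * N (d 0%N).
  elim/ltn_ind: n => -[//|n] IH nm.
  apply: le_trans (eU _ _) _ => //.
  rewrite UdE// th// theta_split// mulrDl mulr_suml.
  apply: le_trans (ND _ _) _; apply: lerD; first exact: La.
  apply: seminorm_sum => // j /andP[j1 jn].
  apply: le_trans (La _ _ _ _ _) _ => //.
  by rewrite mulrAC [_ * a _ _]mulrC ler_wpM2l// IH//; lia.
have : N (d m - (2 ^+ m * (1 - alpha)) *: d 0%N) <=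
    2 ^+ m * alpha * N (d 0%N).
  rewrite dE// addrAC; case: m m0 th hb La Lb eth {dE UdE dS eU Pn} => // m _.
  move=> th hb La Lb eth.
  (* The last perturbation passes through no further layer and costs theta_m; the earlier ones cost
     theta_m - a_(1,m). Hence the 2 theta_m in the condition. *)
  rewrite big_nat_recr// layer_comp_id.
  apply: le_trans (ND _ _) _; apply: le_trans (lerD (Lb _) (ND _ _)) _.
  have le1 : N (\sum_(1 <= j < m.+1) layer_comp U j.+1 m.+1 (e j)) <=
      \sum_(1 <= j < m.+1) (theta j * a j.+1 m.+1 * N (d 0%N)).
    apply: seminorm_sum => // j /andP[j1 jn].
    apply: le_trans (La _ _ _ _ _) _ => //.
    by rewrite mulrAC [_ * a _ _]mulrC ler_wpM2l// eth//; lia.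
  rewrite -mulr_suml in le1.
  have le2 : N (e m.+1) <= theta m.+1 * N (d 0%N) by apply: eth; lia.
  have := th m.+1 ltac:(lia); rewrite theta_split// => thE.
  move: le1 le2 hb thE Nd0; move: (\sum_(_ <= _ < _) (_ * _)) => s.
  move: (N (d 0%N)) (N (e _)) (N _) => q u w le1 le2 hb thE q0.
  nra.
rewrite /d S0 expr0 scale1r /= -scalerA -scalerBr NZ ger0_norm ?exprn_ge0//.
by rewrite -mulrA ler_pM2l// exprn_gt0.
Qed.

(** * The virtual network *)

Lemma pair_ext (A B : Type) (z w : A * B) : z.1 = w.1 -> z.2 = w.2 -> z = w.
Proof. by case: z w => [? ?] [? ?] /= -> ->. Qed.

Lemma bounded_operator_comp (R : realType) (X Y Z : normedModType R)
    (A : X -> Y) (B : Y -> Z) :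
  bounded_operator A -> bounded_operator B -> bounded_operator (B \o A).
Proof.
move=> [M AM] [K BK]; exists (`|K| * M) => x.
have le1 : `|B (A x)| <= `|K| * `|A x|.
  by rewrite (le_trans (BK _))// ler_wpM2r// ler_norm.
by rewrite (le_trans le1)// -mulrA ler_wpM2l.
Qed.

Lemma linear_layer_linear (R : realType) (X Y Z : hilbertType R)
    (T : {linear X -> Y}) (D : {linear X -> Z}) (lam tau eta : nat -> R)
    (n : nat) (c : R) (z w : X * X) :
  bounded_operator T -> bounded_operator D ->
  linear_layer T D lam tau eta n (c *: z + w) =
  c *: linear_layer T D lam tau eta n z + linear_layer T D lam tau eta n w.
Proof.
move=> bT bD; rewrite /linear_layer /= (linearP T) (linearP D) !adjoint_linear//.
apply: pair_ext => /=; vector_field.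
Qed.

Lemma linear_layer_bounded (R : realType) (X Y Z : hilbertType R)
    (T : {linear X -> Y}) (D : {linear X -> Z}) (lam tau eta : nat -> R)
    (n : nat) :
  bounded_operator T -> bounded_operator D ->
  prod_bounded (linear_layer T D lam tau eta n).
Proof.
move=> bT bD.
have [M TM] := bounded_operator_comp bT (adjoint_bounded bT).
have [K DK] := bounded_operator_comp bD (adjoint_bounded bD).
pose C := 1 + `|lam n| * `|M| + `|lam n * tau n| * `|K| + `|lam n| + `|eta n|.
exists C => [|z]; first by rewrite !addr_ge0 ?mulr_ge0.
apply: le_trans (prod_norm_le_add _) _ => /=.
have [le1 le2] := prod_norm_ge_comp z.
have bound (W : X -> X) (q : R) : (forall x, `|W x| <= q * `|x|) ->
    `|W z.1| <= `|q| * prod_norm z.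
  move=> Wq; apply: le_trans (Wq _) _.
  by rewrite (le_trans (ler_wpM2r _ (ler_norm q)))// ler_wpM2l.
apply: le_trans (lerD (ler_normD _ _) (lexx _)) _.
apply: le_trans (lerD (lerD (ler_normB _ _) (lexx _)) (lexx _)) _.
apply: le_trans (lerD (lerD (lerD (ler_normB _ _) (lexx _)) (lexx _)) (lexx _)) _.
rewrite !normrZ /C !mulrDl mul1r -!(mulrA `|_|).
do ?[apply: lerD] => //; rewrite ?normrM -?mulrA; do ?[apply: ler_wpM2l] => //.
  exact: bound TM.
exact: bound DK.
Qed.

Lemma layer_comp_linear (R : realType) (V : lmodType R) (U : nat -> V -> V)
    (i n : nat) :
  (forall n c x y, U n (c *: x + y) = c *: U n x + U n y) ->
  forall c x y, layer_comp U i n (c *: x + y) =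
    c *: layer_comp U i n x + layer_comp U i n y.
Proof.
move=> UL; elim: n => [|n IH] c x y //=.
by case: ifP => // _ /=; rewrite IH UL.
Qed.

Lemma layer_comp_bounded (R : realType) (X : normedModType R)
    (U : nat -> X * X -> X * X) (i n : nat) :
  (forall n, prod_bounded (U n)) -> prod_bounded (layer_comp U i n).
Proof.
move=> UM; have idM : prod_bounded (@id (X * X)%type).
  by exists 1 => // z; rewrite mul1r.
elim: n => [|n [M M0 IH]] //=; case: ifP => // _.
have [K K0 UK] := UM n.+1; exists (K * M) => [|z]; first exact: mulr_ge0.
by rewrite (le_trans (UK _))// -mulrA ler_wpM2l.
Qed.

Lemma beta_prod_recr (R : realType) (lam tau bT bD : nat -> R) (i n p : nat) :
  (i <= n.+1)%N ->
  beta_prod lam tau bT bD i n.+1 p =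
  beta_prod lam tau bT bD i n p * beta_layer lam tau bT bD n.+1 p.
Proof. by move=> le; rewrite /beta_prod big_nat_recr. Qed.

(** The recursion of the corner entry when [[beta, lam], [0, eta]] of layer n + 1 multiplies the
    earlier product on the left. *)
Lemma beta_tilde_recr (R : realType) (lam tau eta bT bD : nat -> R)
    (i n p : nat) : (i <= n)%N ->
  beta_tilde lam tau eta bT bD i n.+1 p =
  beta_layer lam tau bT bD n.+1 p * beta_tilde lam tau eta bT bD i n p
  + lam n.+1 * eta_prod eta i n.
Proof.
move=> le; rewrite /beta_tilde big_nat_recr//=; congr (_ + _).
rewrite mulrDr mulr_sumr; congr (_ + _).
  apply: eq_big_nat => j /andP[_ jn]; rewrite beta_prod_recr; last exact: ltnW.
  by ring.
(* The term of [beta_tilde] that stood outside the sum at stage n becomes its last summand, with a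
   single factor beta. *)
by rewrite /beta_prod big_nat1 mulrA.
Qed.

(** On the plane of v_p each layer acts as an upper triangular 2x2 matrix. In the product the
    diagonal entries multiply and the corner entry obeys [beta_tilde_recr]. *)
Lemma layer_comp_eigen (R : realType) (X Y Z : hilbertType R)
    (T : {linear X -> Y}) (D : {linear X -> Z})
    (v : nat -> X) (bT bD lam tau eta : nat -> R) (i n p : nat) (x b : R) :
  bounded_operator T -> bounded_operator D ->
  (forall p, adjoint T (T (v p)) = bT p *: v p) ->
  (forall p, adjoint D (D (v p)) = bD p *: v p) ->
  (0 < i <= n)%N ->
  layer_comp (linear_layer T D lam tau eta) i n (x *: v p, b *: v p) =
  ((beta_prod lam tau bT bD i n p * x + beta_tilde lam tau eta bT bD i n p * b)
      *: v p,
   (eta_prod eta i n * b) *: v p).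
Proof.
move=> bdT bdD hT hD.
have adjZ (W : hilbertType R) (A : {linear X -> W}) (c q : R) :
    bounded_operator A -> adjoint A (A (v p)) = q *: v p ->
    adjoint A (A (c *: v p)) = (c * q) *: v p.
  move=> bA Aq.
  have a0 : adjoint A 0 = 0.
    by apply: inner_ext => z; rewrite -adjointP// !(innerC _ 0) !inner0l.
  rewrite linearZ /= -[c *: A _]addr0 adjoint_linear// a0 addr0 Aq.
  by rewrite scalerA.
have step k (y d : R) : linear_layer T D lam tau eta k (y *: v p, d *: v p) =
    ((beta_layer lam tau bT bD k p * y + lam k * d) *: v p, (eta k * d) *: v p).
  rewrite /linear_layer /= (adjZ _ T _ (bT p))// (adjZ _ D _ (bD p))// scalerA.
  by apply: pair_ext => /=; rewrite /beta_layer; vector_field.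
case/andP=> i0; elim: n => [|n IH]; first by case: i i0.
rewrite leq_eqVlt => /orP[/eqP iE|]; last first.
  rewrite ltnS => le; rewrite layer_compS ?(leqW le)//= IH// step.
  rewrite beta_prod_recr ?(leqW le)// beta_tilde_recr//.
  have -> : eta_prod eta i n.+1 = eta n.+1 * eta_prod eta i n.
    by rewrite /eta_prod big_nat_recr ?(leqW le)//= mulrC.
  by congr (_ *: _, _ *: _); ring.
(* For a single layer the sum and the eta product in [beta_tilde] are empty, so the corner entry is
   [lam] alone. *)
rewrite iE layer_compS// layer_comp_id /= step.
by rewrite /beta_prod /beta_tilde /eta_prod !big_nat1 !big_geq//= add0r mulr1.
Qed.

Lemma a_constE (R : realType) (lam tau eta bT bD : nat -> R) (i n : nat) :
  a_const lam tau eta bT bD i n =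
  triangular_sup (beta_prod lam tau bT bD i n)
    (beta_tilde lam tau eta bT bD i n) (eta_prod eta i n).
Proof. by []. Qed.

(** Subtracting a multiple of the identity shifts both diagonal entries and leaves the corner;
    beyond that only the order of the summands in c differs. *)
Lemma b_constE (R : realType) (lam tau eta bT bD : nat -> R) (m : nat)
    (alpha : R) :
  b_const lam tau eta bT bD m alpha =
  triangular_sup (fun p => beta_prod lam tau bT bD 1 m p - 2 ^+ m * (1 - alpha))
    (beta_tilde lam tau eta bT bD 1 m)
    (eta_prod eta 1 m - 2 ^+ m * (1 - alpha)).
Proof.
rewrite /b_const /triangular_sup; congr (_ * sup _).
apply: eq_imagel => p _ /=.
by rewrite [_ + beta_tilde _ _ _ _ _ _ _ _ ^+ 2]addrAC.
Qed.

Theorem proposition3p5 (R : realType) (X Y Z : hilbertType R)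
    (evX : X -> R -> R) (evY : Y -> R -> R)
    (hX : function_space evX) (hY : function_space evY)
    (k : R * R -> R) (hk : L2_kernel k)
    (T : {linear X -> Y})
    (hTint : integral_operator evX evY k T) (hTcpt : compact_operator T)
    (D : {linear X -> Z}) (hD : bounded_operator D)
    (hcomm : forall x : X, adjoint T (T (adjoint D (D x)))
                           = adjoint D (D (adjoint T (T x))))
    (v : nat -> X) (hv : orthonormal_basis v)
    (bT bD : nat -> R)
    (hbT : forall p : nat, adjoint T (T (v p)) = bT p *: v p)
    (hbD : forall p : nat, adjoint D (D (v p)) = bD p *: v p)
    (g : X -> \bar R)
    (hgproper : proper_function g) (hglsc : lower_semicontinuous g)
    (hgconvex : convex_ereal g)
    (m : nat) (hm : (0 < m)%N)
    (lam mu tau eta : nat -> R)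
    (hpos : forall n : nat, (1 <= n <= m)%N ->
              [/\ 0 < lam n, 0 < mu n, 0 < tau n & 0 < eta n])
    (theta : nat -> R)
    (htheta0 : theta 0%N = 1)
    (htheta : forall n : nat, (1 <= n <= m)%N ->
       theta n = \sum_(1 <= i < n.+1)
                    theta i.-1 * Num.sqrt (a_const lam tau eta bT bD i n))
    (alpha : R) (halpha : 2^-1 <= alpha <= 1)
    (hcond : Num.sqrt (b_const lam tau eta bT bD m alpha)
               - Num.sqrt (a_const lam tau eta bT bD 1 m)
             <= 2 ^+ m * alpha - 2 * theta m) :
  averaged prod_norm alpha (virtual_network T D g lam mu tau eta m).
Proof.
have bdT := compact_operator_bounded hTcpt.
pose U := linear_layer T D lam tau eta.
(* The reflection 2 Q_n - Id: on the second component Q_n is the identity, and so is its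
   reflection. *)
pose P n (z : X * X) : X * X :=
  (2 *: prox (fun y => (lam n * mu n)%:E * g y)%E z.1 - z.1, z.2).
have UL n c z w : U n (c *: z + w) = c *: U n z + U n w.
  exact: linear_layer_linear.
have UM n : prod_bounded (U n) by exact: linear_layer_bounded.
pose gam := 2 ^+ m * (1 - alpha).
apply: (@network_averaged _ _ _ U P _ _ _ _ _ _ hm _ _ _ _ _ _ _ _ _ _
  htheta0 htheta hcond) => //.
- by case/andP: halpha.
- exact: prod_normD.
- exact: prod_normZ.
- move=> n z w /hpos[lam0 mu0 _ _].
  have c0 : 0 < lam n * mu n by rewrite mulr_gt0.
  have cc := closed_convex_scale c0 (closed_convex_fine hgproper hglsc hgconvex).
  have := @prox_reflection_nonexpansive R X _ _
    (fun y => (lam n * mu n)%:E * g y)%E z.1 w.1 cc.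
  move=> /(_ _ _)/wrap[y /= gy|y /=|]; last 1 first.
  - move=> le; rewrite -(@ler_pXn2r _ 2)// ?nnegrE ?prod_norm_ge0//.
    by rewrite !sqr_prod_norm /= lerD2r lerXn2r ?nnegrE.
  - by rewrite -[g y in LHS]fineK ?fin_numE ?hgproper.1 ?gy// EFinM.
  - by move=> /negP; rewrite negbK => /eqP ->; rewrite gt0_muley// lte_fin.
- move=> n z; rewrite [LHS]/= /P /prox_layer /=.
  by apply: pair_ext => /=; vector_field.
- move=> i n z /andP[i0 le] _; rewrite a_constE.
  apply: triangular_norm_bound hv _ _ _ _.
  + exact: layer_comp_linear.
  + exact: layer_comp_bounded.
  + by move=> p x b; apply: layer_comp_eigen; rewrite ?i0.
- move=> z; rewrite b_constE -/gam.
  apply: (triangular_norm_bound (A := fun z => layer_comp U 1 m z - gam *: z)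
    hv).
  + by move=> c w y; rewrite layer_comp_linear//; apply: pair_ext => /=; vector_field.
  + have [M M0 LM] := @layer_comp_bounded _ _ _ 1 m UM.
    exists (M + `|gam|) => [|w]; first by rewrite addr_ge0.
    apply: le_trans (prod_normD _ _) _.
    by rewrite mulrDl lerD// -scaleN1r !prod_normZ normrN1 mul1r.
  + move=> p x b; rewrite (layer_comp_eigen _ _ _ _ _ _ bdT hD hbT hbD)//.
    by apply: pair_ext => /=; vector_field.
Qed.
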